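(* Let $0<s<\infty$ and let $(X,\mathscr{B},\mu,\rho)$ be a compact Ahlfors $s$-regular probability space. Let $\{B_n\}_{n\ge1}$ be a sequence of balls in $X$ with $\operatorname{diam} B_n$ decreasing to $0$ as $n\to\infty$. Let $t\in(0,s]$. If $\mu\big(\limsup_{n\to\infty}B_n^t\big)=1$, then $\limsup_{n\to\infty}B_n\in\mathcal{G}^t(X)$.
   Context: For a metric space $(X,\rho)$, $B(x,r)=\{y\in X:\rho(x,y)<r\}$ and $\overline{B}(x,r)=\{y\in X:\rho(x,y)\le r\}$; a ball is an open ball $B=B(x,r)$ with given centre $x$ and radius $r>0$, and $B^t$ denotes $B(x,r^{t/s})$. $\mathscr{B}$ is the Borel $\sigma$-algebra. A Borel measure $\mu$ is Ahlfors $s$-regular ($0<s<\infty$) if there is $1\le C<\infty$ with $C^{-1}r^s\le\mu(B(x,r))\le Cr^s$ for all $x\in X$ and $0<r\le\operatorname{diam}X$. A compact Ahlfors $s$-regular probability space $(X,\mathscr{B},\mu,\rho)$ means: $(X,\rho)$ is a compact metric space and $\mu$ is an Ahlfors $s$-regular Borel probability measure on it (this is a standing assumption); then $\tau:=\dim_{\rm H}X=s$. For sets $F_n$, $\limsup_{n\to\infty}F_n=\bigcap_{m\ge1}\bigcup_{n\ge m}F_n$. Generalized dyadic cubes: fix $0<b<1/3$ and put $c_1=\frac12-\frac{b}{1-b}$, $c_1'=\frac1{1-b}$. Fix a family of Borel sets $\{Q_{n,i}: n\in\mathbb{Z}, i\in\mathbb{N}_n\subset\mathbb{N}\}$ (which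 exists by a known theorem) such that: (1) $X=\bigcup_{i\in\mathbb{N}_n}Q_{n,i}$ for every $n$, the sets $Q_{n,i}$ with the same $n$ and distinct $i$ being disjoint; (2) for $n\ge m$, either $Q_{n,i}\cap Q_{m,j}=\varnothing$ or $Q_{n,i}\subset Q_{m,j}$; (3) for each $n,i$ there is $x_{n,i}\in X$ with $B(x_{n,i},c_1b^n)\subset Q_{n,i}\subset\overline{B}(x_{n,i},c_1'b^n)$; (4) there is $x_0\in X$ such that for every $n$ there is $i$ with $B(x_0,c_1b^n)\subset Q_{n,i}$; (5) $\{x_{n,i}\}_{i\in\mathbb{N}_n}\subset\{x_{n+1,i}\}_{i\in\mathbb{N}_{n+1}}$ for all $n$. Put $\mathcal{Q}_0=\{X\}$, $\mathcal{Q}_n=\{Q_{n,i}:i\in\mathbb{N}_n\}$ for $n\ge1$, and $\mathcal{Q}=\bigcup_{n\ge0}\mathcal{Q}_n$. Large intersection classes: for $0<t\le\tau$ and $F\subset X$ let $\mathscr{M}^t_\infty(F)=\inf\{\sum_{i}\mu(Q_i)^{t/\tau}: F\subset\bigcup_{i}Q_i,\ Q_i\in\mathcal{Q}\}$ (countable covers). $\mathcal{G}^t(X)$ is the class of all $G_\delta$ sets $F\subset X$ such that for every $0<t'<t$ and every $Q\in\mathcal{Q}$, $\mathscr{M}^{t'}_\infty(F\cap Q)=\mathscr{M}^{t'}_\infty(Q)$. *)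

(* Defs.v *)
From HB Require Import structures.
From mathcomp Require Import all_boot all_order all_algebra.
From mathcomp Require Import all_classical all_reals all_analysis borel_hierarchy.

Set Implicit Arguments.
Unset Strict Implicit.
Unset Printing Implicit Defensive.

Import Order.TTheory GRing.Theory Num.Theory.
Import numFieldNormedType.Exports.

Local Open Scope classical_set_scope.
Local Open Scope ring_scope.

(* Measurable types are pointed in MathComp-Analysis.  This costs no generality
   for a space that carries a probability measure, since it is nonempty. *)
#[short(type="pmetricType")]
HB.structure Definition PointedMetric (K : numDomainType) :=
  { M of Pointed M & Metric K M }.

Notation borel X := (g_sigma_algebraType (@open X)).

Section metric_notions.
Context {R : realType} {X : metricType R}.

(* The library's [closed_ball] is the closure of the open ball, which can be
   smaller than this set. *)
Definition cball (x : X) (r : R) : set X := [set y | mdist x y <= r].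

(* 0 is added so that the empty set has diameter 0. *)
Definition diam (A : set X) : \bar R :=
  ereal_sup (0%E |` [set (mdist x y)%:E | x in A & y in A]).

Definition hausdorff_premeasure (p delta : R) (A : set X) : \bar R :=
  ereal_inf [set (\sum_(i <oo) diam (U i) `^ p)%E | U in
    [set U : (set X)^nat | A `<=` \bigcup_i U i
                           /\ forall i, (diam (U i) <= delta%:E)%E]].

Definition hausdorff_measure (p : R) (A : set X) : \bar R :=
  ereal_sup [set hausdorff_premeasure p delta A | delta in [set delta | 0 < delta]].

Definition hausdorff_dim (A : set X) : \bar R :=
  ereal_inf [set p%:E | p in [set p | 0 < p /\ hausdorff_measure p A = 0%E]].

End metric_notions.

Definition ahlfors_regular (R : realType) (X : pmetricType R) (s : R)
    (mu : {measure set (borel X) -> \bar R}) : Prop :=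
  exists2 C : R, 1 <= C & forall (x : X) (r : R),
    0 < r -> (r%:E <= diam [set: X])%E ->
    ((C^-1 * r `^ s)%:E <= mu (ball x r))%E
    /\ (mu (ball x r) <= (C * r `^ s)%:E)%E.

(* [I n] is the index set of the cubes of generation [n], and [x n i] is the
   centre of the cube [Q n i]; their values at [i] outside [I n] are irrelevant. *)
Record dyadic_cubes (R : realType) (X : pmetricType R) (b : R)
    (I : int -> set nat) (Q : int -> nat -> set X) (x : int -> nat -> X) : Prop :=
  DyadicCubes {
    dyadic_borel : forall n i, I n i -> measurable (Q n i : set (borel X)) ;
    dyadic_cover : forall n, \bigcup_(i in I n) Q n i = [set: X] ;
    dyadic_disjoint : forall n, trivIset (I n) (Q n) ;
    dyadic_nested : forall m n i j, m <= n -> I n i -> I m j ->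
      Q n i `&` Q m j = set0 \/ Q n i `<=` Q m j ;
    dyadic_inner : forall n i, I n i ->
      ball (x n i) ((1 / 2 - b / (1 - b)) * b ^ n) `<=` Q n i ;
    dyadic_outer : forall n i, I n i ->
      Q n i `<=` cball (x n i) (1 / (1 - b) * b ^ n) ;
    dyadic_origin : exists x0 : X, forall n, exists2 i, I n i &
      ball x0 ((1 / 2 - b / (1 - b)) * b ^ n) `<=` Q n i ;
    dyadic_centres : forall n,
      [set x n i | i in I n] `<=` [set x (n + 1) i | i in I (n + 1)]
  }.

Section large_intersection.
Context {R : realType} {X : pmetricType R}.
Variables (mu : {measure set (borel X) -> \bar R}).
Variables (I : int -> set nat) (Q : int -> nat -> set X).

Definition cube_generation (n : nat) : set (set X) :=
  if n == 0%N then [set [set: X]] else [set Q n%:Z i | i in I n%:Z].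

Definition cubes : set (set X) := \bigcup_n cube_generation n.

(* The index set [D] makes room for finite covers, since every cube is nonempty
   and a cover cannot be padded with the empty set. *)
Definition net_content (t : R) (F : set X) : \bar R :=
  ereal_inf [set (\esum_(i in DA.1)
                    mu (DA.2 i) `^ (t / fine (hausdorff_dim [set: X])))%E | DA in
    [set DA : set nat * (set X)^nat |
       (forall i, DA.1 i -> cubes (DA.2 i))
       /\ F `<=` \bigcup_(i in DA.1) DA.2 i]].

Definition large_intersection_class (t : R) : set (set X) :=
  [set F | Gdelta F /\ forall (t' : R) (A : set X), 0 < t' -> t' < t -> cubes A ->
     net_content t' (F `&` A) = net_content t' A].

End large_intersection.

(* Main.v *)
Require Import Defs.
From HB Require Import structures.
From mathcomp Require Import all_boot all_order all_algebra.
From mathcomp Require Import all_classical all_reals all_analysis.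
From mathcomp Require Import ring lra.

Set Implicit Arguments.
Unset Strict Implicit.
Unset Printing Implicit Defensive.

Import Order.TTheory GRing.Theory Num.Theory.
Import numFieldNormedType.Exports.

Local Open Scope classical_set_scope.
Local Open Scope ring_scope.

(** Write F for the upper limit of the balls B_n, and R_n = r_n ^ (t / s) for the
    radii of the enlarged balls B_n^t.  Fix 0 < u < t, and let X have more than
    one point (otherwise F = X).  The content of exponent u involves the
    Hausdorff dimension of X, which is s ([hausdorff_dim_space]).  For a cube A
    the cover of A by itself shows that this content is at most mu(A) ^ (u / s),
    so that everything reduces to one inequality: a cover of F `&` A by cubes
    C_i has
      mu(A) ^ (u / s) <= sum_i mu(C_i) ^ (u / s).

    The core is a version of the inequality with balls and with a loss
    ([limsup_cover_mass]): there is lam > 0 such that any balls of radii rho_i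
    covering F inside a ball of radius d <= 1 satisfy
    (lam d) ^ u <= sum_i rho_i ^ u.  Call a ball of radius d light when the
    covering balls that touch it violate this bound.  A light ball contains
    light balls B(c_n, r_n / 2) with n as large as desired
    ([light_ball_refine]).  Indeed the hypothesis mu(limsup B_n^t) = 1 and a
    Vitali argument give disjoint enlarged balls of radii R_n inside the light
    ball, with sum R_n ^ s comparable to d ^ s.  If no B(c_n, r_n / 2) is light,
    then each n falls in one of two cases.  Either a covering ball of radius at
    least R_n / 4 touches B(c_n, r_n / 2); the enlarged balls of this kind lie
    in dilations of the touching covering balls, whose total measure is at most
    a constant times (lam d) ^ s, a small part of d ^ s.  Or all the covering
    balls touching B(c_n, r_n / 2) lie in the enlarged ball; they are then
    different for different n, and together they carry at least
    sum (lam r_n / 2) ^ u, which is much more than sum R_n ^ s = sum r_n ^ t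
    because u < t and r_n is small.  Both cases together contradict the lower
    bound on sum R_n ^ s.  Iterating the refinement yields nested closed balls,
    whose common point belongs to F; the covering ball that contains it touches
    arbitrarily small light balls, which is absurd.

    Finally the loss is removed ([cube_mass_le_cover]).  If
    sum_i mu(C_i) ^ (u / s) < mu(A) ^ (u / s), then each mu(C_i) is below mu(A),
    and u / s < 1 gives sum_i mu(C_i) < mu(A), so that E = A minus the C_i has
    positive measure.  A cube of a fine generation N that meets E lies in no
    C_i, hence contains every C_i that it meets, and the bound with loss applies
    to it.  Summing over these disjoint cubes gives
    mu(E) <= const (b ^ N) ^ (s - u), which tends to 0. *)

(** * Sums over arbitrary index sets, measures and real powers *)

Section esum_facts.
Context {R : realType}.

Lemma esum_subset (T : choiceType) (A B : set T) (f : T -> \bar R) :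
  A `<=` B -> (\esum_(i in A) f i <= \esum_(i in B) f i)%E.
Proof.
move=> AB; apply: ereal_sup_le => _ [F [finF FA] <-].
by exists F => //; split => //; exact: subset_trans AB.
Qed.

Lemma esum_ge_term (T : choiceType) (A : set T) (f : T -> \bar R) i :
  (forall j, (0 <= f j)%E) -> A i -> (f i <= \esum_(j in A) f j)%E.
Proof.
move=> f0 Ai; rewrite -(@esum_set1 _ _ i f)//.
by apply: esum_subset => _ ->.
Qed.

Lemma esum_le_scale (T : choiceType) (A : set T) (f g : T -> \bar R) (k : R) :
  0 <= k -> (forall i, (0 <= g i)%E) ->
  (forall i, A i -> (f i <= k%:E * g i)%E) ->
  (\esum_(i in A) f i <= k%:E * \esum_(i in A) g i)%E.
Proof.
move=> k0 g0 fg; apply/ereal_supP => _ [F [finF FA] <-].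
apply: (@le_trans _ _ (\sum_(i \in F) k%:E * g i)%E).
  by apply: lee_fsum => // i /FA; exact: fg.
rewrite -ge0_mule_fsumr//; apply: lee_wpmul2l; first by rewrite lee_fin.
by apply: ereal_sup_ubound; exists F.
Qed.

Lemma measure_le_esum d (T : measurableType d) (mu : {measure set T -> \bar R})
    (A : set nat) (F : nat -> set T) (B : set T) :
  measurable B -> (forall i, A i -> measurable (F i)) ->
  B `<=` \bigcup_(i in A) F i -> (mu B <= \esum_(i in A) mu (F i))%E.
Proof.
move=> mB mF BF.
pose F' i := if i \in A then F i else set0.
have mF' i : measurable (F' i).
  by rewrite /F'; case: ifPn => // /set_mem; exact: mF.
have BF' : B `<=` \bigcup_i F' i.
  by move=> x /BF[i Ai Fx]; exists i => //; rewrite /F' mem_set.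
apply: le_trans (measure_sigma_subadditive mu mF' mB BF') _.
rewrite nneseries_esumT// [leRHS]esum_mkcond; apply: le_esum => i _.
by rewrite /F'; case: ifPn => // _; rewrite measure0.
Qed.

Lemma measure_bigcup_esum d (T : measurableType d)
    (mu : {measure set T -> \bar R}) (A : set nat) (F : nat -> set T) :
  (forall i, A i -> measurable (F i)) -> trivIset A F ->
  mu (\bigcup_(i in A) F i) = \esum_(i in A) mu (F i).
Proof.
by move=> mF tF; rewrite measure_bigcup// nneseries_esum// set_mem_set.
Qed.

(** The index sets [J k] are only disjoint for [k] in [K]; emptying the other
    ones makes the family disjoint over all of [nat]. *)
Lemma esum_disjoint_le (T : choiceType) (K : set nat) (J : nat -> set T)
    (A : set T) (f : T -> \bar R) :
  trivIset K J -> (forall k, K k -> J k `<=` A) -> (forall i, (0 <= f i)%E) ->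
  (\esum_(k in K) \esum_(i in J k) f i <= \esum_(i in A) f i)%E.
Proof.
move=> tJ JA f0.
pose J' k := if k \in K then J k else set0.
have tJ' : trivIset setT J'.
  move=> i j _ _; rewrite /J'.
  case: ifPn => [/set_mem Ki|_]; last by rewrite set0I => /set0P; rewrite eqxx.
  case: ifPn => [/set_mem Kj|_]; last by rewrite setI0 => /set0P; rewrite eqxx.
  exact: tJ.
rewrite (eq_esum (b := fun k => \esum_(i in J' k) f i)); last first.
  by move=> k Kk; rewrite /J' mem_set.
rewrite -esum_bigcupT//; apply: esum_subset => i [k Kk].
by rewrite /J' mem_set//; exact: JA.
Qed.

End esum_facts.

Lemma powRVK (R : realType) (a p : R) : 0 <= a -> p != 0 ->
  (a `^ p^-1) `^ p = a.
Proof. by move=> a0 p0; rewrite -powRrM mulVf// powRr1. Qed.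

Lemma powR_le (R : realType) (p a b : R) : 0 <= p -> 0 <= a -> a <= b ->
  a `^ p <= b `^ p.
Proof.
by move=> p0 a0 ab; apply: ge0_ler_powR => //; rewrite nnegrE// (le_trans a0).
Qed.

Lemma powR_lt (R : realType) (p a b : R) : 0 < p -> 0 <= a -> a < b ->
  a `^ p < b `^ p.
Proof.
by move=> p0 a0 ab; apply: gt0_ltr_powR => //; rewrite nnegrE// (le_trans a0)// ltW.
Qed.

Lemma powR_split (R : realType) (a p q : R) : 0 < a ->
  a `^ p = a `^ (p - q) * a `^ q.
Proof. by move=> a0; rewrite -powRD ?subrK// (gt_eqF a0) implybT. Qed.

(** * A finite covering lemma in metric spaces *)

Section metric_facts.
Context {R : realType} {X : pmetricType R}.
Implicit Types (x y z : X) (r d : R).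

Lemma in_ballE x r y : ball x r y = (mdist x y < r) :> Prop.
Proof. by rewrite ballEmdist. Qed.

Lemma open_mball x r : open (ball x r).
Proof.
rewrite openE => y; rewrite in_ballE => xy; apply/nbhs_ballP.
exists (r - mdist x y) => /=; first by rewrite subr_gt0.
move=> z; rewrite !in_ballE => yz.
have := metric_triangle x y z; lra.
Qed.

Lemma measurable_mball x r : measurable (ball x r : set (borel X)).
Proof. by apply: sub_sigma_algebra; exact: open_mball. Qed.

(** Greedy choice: keep a ball of largest radius, discard the balls that meet
    it, which all lie in its threefold dilation, and recurse on the others. *)
Lemma disjoint_vitali_subfamily (c : nat -> X) (r : nat -> R) (s : seq nat) :
  exists D : seq nat, [/\ {subset D <= s},
    trivIset [set` D] (fun n => ball (c n) (r n)) &
    \bigcup_(n in [set` s]) ball (c n) (r n) `<=`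
    \bigcup_(n in [set` D]) ball (c n) (3 * r n)].
Proof.
have [m] := ubnP (size s); elim: m s => // m IHm s.
have [-> _|s_neq0 sm] := eqVneq s [::].
  by exists [::]; split => // x [n]; rewrite /= in_nil.
have [k ks kmax] : exists2 k, k \in s & forall n, n \in s -> r n <= r k.
  elim: s s_neq0 {sm} => // a s IHs _.
  have [->|/IHs[k ks kmax]] := eqVneq s [::].
    by exists a; rewrite ?mem_head// => n; rewrite inE => /eqP ->.
  have [ak|ka] := leP (r a) (r k).
    exists k; first by rewrite inE ks orbT.
    by move=> n; rewrite inE => /predU1P[->//|]; exact: kmax.
  exists a; first exact: mem_head.
  by move=> n; rewrite inE => /predU1P[->//|/kmax/le_trans]; apply; exact: ltW.
pose disj n := `[< ball (c n) (r n) `&` ball (c k) (r k) = set0 >].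
have [|D [Ds tD sD]] := IHm [seq n <- s | disj n & n != k].
  rewrite -ltnS; apply: leq_trans sm; rewrite ltnS size_filter.
  rewrite -(count_predC (predC1 k) s).
  rewrite (leq_ltn_trans (n := count (predC1 k) s))//.
    by apply: sub_count => n /= /andP[].
  rewrite -[ltnLHS]addn0 ltn_add2l -has_count.
  by apply/hasP; exists k => //=; rewrite negbK.
exists (k :: D); split.
- by move=> n; rewrite inE => /predU1P[->//|/Ds]; rewrite mem_filter => /andP[].
- have kD n : n \in D -> ball (c n) (r n) `&` ball (c k) (r k) = set0.
    by move=> /Ds; rewrite mem_filter => /andP[/andP[/asboolP]].
  move=> i j /=; rewrite !inE.
  move=> /predU1P[->|iD] /predU1P[->|jD]//; first last.
  + exact: tD.
  + by rewrite kD// => /set0P/eqP.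
  + by rewrite setIC kD// => /set0P/eqP.
- move=> x [n ns nx].
  have [dn|] := boolP (disj n && (n != k)).
    have [|j /= jD jx] := sD x; first by exists n => //=; rewrite mem_filter dn.
    by exists j => //=; rewrite inE jD orbT.
  rewrite negb_and negbK => meets; exists k; first by rewrite /= mem_head.
  move: nx; rewrite !in_ballE => nx.
  case/orP: meets => [/asboolPn/eqP/set0P[y]|/eqP nk]; last first.
    rewrite nk in nx.
    by have := mdist_ge0 (c k) x; lra.
  rewrite /setI/= !in_ballE => -[ny ky].
  have := metric_triangle (c k) y x; have := metric_triangle y (c n) x.
  rewrite (metric_sym y (c n)); have := kmax _ ns; lra.
Qed.

End metric_facts.

(** * The measure of balls in an Ahlfors regular space *)

Section ball_growth.
Context {R : realType} {X : pmetricType R}.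
Implicit Types (x y z : X) (s K : R).

(** Ahlfors regularity freed from the diameter: the upper bound holds for all
    radii and the lower bound for all radii up to 1. *)
Definition ball_growth s K (mu : set X -> \bar R) := [/\ 1 <= K,
  forall x r, 0 < r -> (mu (ball x r) <= (K * r `^ s)%:E)%E &
  forall x r, 0 < r -> r <= 1 -> ((K^-1 * r `^ s)%:E <= mu (ball x r))%E].

Lemma mdist_le_diam (A : set X) x y : A x -> A y -> ((mdist x y)%:E <= diam A)%E.
Proof.
move=> Ax Ay; apply: ereal_sup_ubound; right.
by exists x => //; exists y.
Qed.

Lemma diam_le (A : set X) (d : R) : 0 <= d ->
  (forall x y, A x -> A y -> mdist x y <= d) -> (diam A <= d%:E)%E.
Proof.
move=> d0 Ad; apply/ereal_supP => _ [->|[x Ax [y Ay <-]]]; rewrite lee_fin//.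
exact: Ad.
Qed.

(** Balls of radius larger than the diameter are the whole space and have
    measure 1.  Two distinct points make the diameter positive, which is what
    the upper bound needs; in a one-point space it fails for small radii. *)
Lemma ahlfors_ball_growth (mu : probability (borel X) R) s x y :
  0 < s -> x != y -> ahlfors_regular s mu -> exists K, ball_growth s K mu.
Proof.
move=> s0 xy [C C1 HC].
have xyd : ((mdist x y)%:E <= diam [set: X])%E by exact: mdist_le_diam.
have large r z : (diam [set: X] < r%:E)%E -> mu (ball z r) = 1%E.
  move=> dr; rewrite (_ : ball z r = setT) ?probability_setT//.
  apply/seteqP; split => // w _; rewrite in_ballE -lte_fin.
  by apply: le_lt_trans dr; exact: mdist_le_diam.
have d0 : 0 < mdist x y by rewrite mdist_gt0.
pose K := Num.max C ((mdist x y) `^ s)^-1.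
have CK : C <= K by rewrite le_max lexx.
have K0 : 0 < K by rewrite (lt_le_trans _ CK)// (lt_le_trans _ C1).
exists K; split => [|z r r0|z r r0 r1]; first exact: le_trans CK.
- have [rd|dr] := leP r%:E (diam [set: X]).
    apply: le_trans (HC z r r0 rd).2 _.
    by rewrite lee_fin ler_wpM2r// powR_ge0.
  rewrite large// lee_fin.
  apply: (@le_trans _ _ (((mdist x y) `^ s)^-1 * r `^ s)).
    rewrite -[leLHS](@mulVf _ (mdist x y `^ s)) ?gt_eqF ?powR_gt0//.
    rewrite ler_wpM2l// ?invr_ge0 ?powR_ge0//.
    apply: powR_le; rewrite ?mdist_ge0//; first exact: ltW.
    by rewrite -lee_fin; apply: le_trans (ltW dr).
  by rewrite ler_wpM2r ?powR_ge0// le_max lexx orbT.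
- have [rd|dr] := leP r%:E (diam [set: X]).
    apply: le_trans (HC z r r0 rd).1.
    rewrite lee_fin ler_wpM2r// ?powR_ge0// lef_pV2// posrE.
    exact: lt_le_trans C1.
  rewrite large// lee_fin mulr_ile1 ?powR_ge0 ?invr_ge0 ?(ltW K0)//.
    by rewrite invf_le1// (le_trans C1).
  rewrite -[leRHS](congr1 (@^~ s) (powR1 R)); apply: powR_le => //; exact: ltW.
Qed.

(** A ball of small diameter coincides with a small concentric ball, so that its
    measure is small; the lower bound on the measure then makes the given
    radius small as well. *)
Lemma radius_to0 (mu : {measure set (borel X) -> \bar R}) s K (c : X^nat)
    (r : R^nat) : 0 < s -> ball_growth s K mu ->
  diam (ball (c n) (r n)) @[n --> \oo] --> 0%E ->
  forall e, 0 < e -> exists N, forall n, (N <= n)%N -> r n < e.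
Proof.
move=> s0 [K1 mu_le mu_ge] diam0 e e0.
have K0 : 0 < K by lra.
pose e' := Num.min e 1; have e'0 : 0 < e' by rewrite lt_min e0 ltr01.
have [e'1 e'e] : e' <= 1 /\ e' <= e by rewrite !ge_min !lexx orbT.
(* chosen so that a ball of radius [e' * q] has less than the least possible
   measure of a ball of radius [e'] *)
pose q := ((2 * K ^+ 2)^-1) `^ s^-1.
have q0 : 0 < q by rewrite powR_gt0// invr_gt0 mulr_gt0// exprn_gt0.
have qs : q `^ s = (2 * K ^+ 2)^-1.
  by rewrite powRVK ?gt_eqF// invr_ge0 mulr_ge0// exprn_ge0// ltW.
have nb : nbhs (0%E : \bar R) [set d | (d < (e' * q)%:E)%E].
  apply: open_nbhs_nbhs; split; first exact: open_ereal_lt_ereal.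
  by rewrite /= lte_fin mulr_gt0.
have [N _ NP] := diam0 _ nb.
exists N => n /NP/= dn; rewrite ltNge; apply/negP => ern.
have sub : ball (c n) e' `<=` ball (c n) (e' * q).
  move=> y; rewrite !in_ballE => ye; rewrite -lte_fin.
  apply: le_lt_trans dn; apply: mdist_le_diam; rewrite in_ballE.
    by rewrite mdistxx; lra.
  by lra.
have : ((K^-1 * e' `^ s)%:E <= (K * (e' * q) `^ s)%:E)%E.
  apply: le_trans (mu_ge (c n) _ e'0 e'1) _.
  apply: le_trans (mu_le (c n) _ (mulr_gt0 e'0 q0)).
  by apply: le_measure => //; rewrite inE; exact: measurable_mball.
rewrite lee_fin (powRM s (ltW e'0) (ltW q0)) qs.
have -> : K * (e' `^ s * (2 * K ^+ 2)^-1) = (K^-1 * e' `^ s) / 2.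
  by field; rewrite gt_eqF.
have : 0 < K^-1 * e' `^ s by rewrite mulr_gt0 ?invr_gt0 ?powR_gt0.
lra.
Qed.

End ball_growth.

(** * Disjoint balls extracted from an upper limit of full measure *)

Section disjoint_balls.
Context {R : realType} {X : pmetricType R}.
Variables (mu : probability (borel X) R) (s K : R).
Hypothesis growth : ball_growth s K mu.
Implicit Types (x y : X) (A : set nat) (z : nat -> X) (rho : nat -> R).

Let K_ge1 : 1 <= K. Proof. by case: growth. Qed.
Let K_gt0 : 0 < K. Proof. by rewrite (lt_le_trans _ K_ge1). Qed.
Let mu_le x r : 0 < r -> (mu (ball x r) <= (K * r `^ s)%:E)%E.
Proof. by case: growth => _ + _; apply. Qed.
Let mu_ge x r : 0 < r -> r <= 1 -> ((K^-1 * r `^ s)%:E <= mu (ball x r))%E.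
Proof. by case: growth => _ _; apply. Qed.

Lemma measurable_bigcup_balls (D : set nat) (c : nat -> X) (r : nat -> R) :
  measurable (\bigcup_(n in D) ball (c n) (r n) : set (borel X)).
Proof. by apply: bigcup_measurable => n _; exact: measurable_mball. Qed.

(** Up to a null set the balls of index at least [N] cover the concentric ball
    of radius [d / 2], so finitely many of them cover a part of measure at least [L], half
    of the lower bound for the measure of [ball y (d / 2)].
    Radii below [d / 4] keep inside [ball y d] those that meet [ball y (d / 2)],
    and the covering lemma makes them disjoint at the cost of the factor
    [3 `^ s]. *)
Lemma full_limsup_disjoint_balls (c : X^nat) (r : R^nat) y d N :
  (forall n, 0 < r n) ->
  (forall e, 0 < e -> exists M, forall n, (M <= n)%N -> r n < e) ->
  mu (lim_sup_set (fun n => ball (c n) (r n))) = 1%E ->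
  0 < d -> d <= 1 ->
  exists D : set nat, [/\ forall n, D n -> (N <= n)%N,
    trivIset D (fun n => ball (c n) (r n)),
    forall n, D n -> ball (c n) (r n) `<=` ball y d &
    ((d `^ s)%:E <=
       (2 * K ^+ 2 * 6 `^ s)%:E * \esum_(n in D) (r n `^ s)%:E)%E].
Proof.
move=> r_gt0 r_to0 full d0 d1.
have [|M rM] := r_to0 (d / 4); first by rewrite divr_gt0.
pose N1 := maxn N M.
pose B n := ball (c n) (r n); pose V := ball y (d / 2).
have mB D : measurable (\bigcup_(n in D) B n : set (borel X)).
  exact: measurable_bigcup_balls.
have mV : measurable (V : set (borel X)) by exact: measurable_mball.
pose G := \bigcup_(n in [set n | (N1 <= n)%N]) B n.
have muG : mu G = 1%E.
  apply/eqP; rewrite eq_le probability_le1//=; last exact: mB.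
  by rewrite -full; apply: lim_sup_set_ub => k; exact: measurable_mball.
pose F k := V `&` \bigcup_(n in [set n | (N1 <= n < N1 + k)%N]) B n.
have mF k : measurable (F k : set (borel X)) by apply: measurableI.
have FE : \bigcup_k F k = V `&` G.
  apply/seteqP; split => [x [k _ [Vx [n /= /andP[Nn _] Bx]]]|x [Vx [n /= Nn Bx]]].
    by split => //; exists n.
  exists n.+1 => //; split => //; exists n => //=.
  by rewrite Nn addnS ltnS leq_addl.
have muVG : mu (V `&` G) = mu V.
  have mG : measurable (G : set (borel X)) by exact: mB.
  have VG0 : mu (V `\` G) = 0%E.
    apply/eqP; rewrite -measure_le0.
    have <- : mu (~` G) = 0%E by rewrite probability_setC// muG subee.
    by apply: le_measure; rewrite ?inE//; [exact: measurableD|exact: measurableC].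
  apply/esym/(eq_trans (measureDI mu mV mG)).
  by rewrite -[RHS]add0e; congr (_ + _)%E; exact: VG0.
pose L := 2^-1 * (K^-1 * (d / 2) `^ s).
have L0 : 0 < L by rewrite !mulr_gt0 ?invr_gt0 ?powR_gt0 ?divr_gt0.
have LV : (L%:E < mu V)%E.
  apply: (@lt_le_trans _ _ (K^-1 * (d / 2) `^ s)%:E); last first.
    by apply: mu_ge; lra.
  by rewrite lte_fin; rewrite /L in L0 *; lra.
have [k Fk] : exists k, (L%:E <= mu (F k))%E.
  apply/not_existsP => FL; move: LV; apply/negP; rewrite -leNgt -muVG -FE.
  have ndF : {homo F : n m / (n <= m)%N >-> (n <= m)%O}.
    move=> n m nm; apply/subsetPset => x [Vx [j /= /andP[Nj jn] Bx]].
    split => //; exists j => //=.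
    by rewrite Nj/= (leq_trans jn)// leq_add2l.
  have mUF : measurable (\bigcup_k F k : set (borel X)).
    exact: bigcup_measurable.
  have cvgF := nondecreasing_cvg_mu (mu := mu) mF mUF ndF.
  rewrite -(cvg_lim _ cvgF)//; apply: lime_le.
    by apply/cvg_ex; eexists; exact: cvgF.
  by apply: nearW => j /=; rewrite leNgt; apply/negP => /ltW; exact: FL.
pose near_V n := `[< B n `&` V !=set0 >].
have [D [Ds tD sD]] := disjoint_vitali_subfamily c r [seq n <- iota N1 k | near_V n].
have DN n : n \in D -> (N1 <= n)%N /\ B n `&` V !=set0.
  move=> /Ds; rewrite mem_filter mem_iota => /andP[/asboolP nV /andP[Nn _]].
  by split.
exists [set` D]; split => //.
- by move=> n /DN[+ _]; apply: leq_trans; exact: leq_maxl.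
- move=> n /DN[Nn [w]]; rewrite /setI/= /B /V !in_ballE => -[nw yw] x.
  rewrite !in_ballE => nx.
  have := rM n (leq_trans (leq_maxr _ _) Nn).
  have := metric_triangle y w x; have := metric_triangle w (c n) x.
  rewrite (metric_sym w (c n)); lra.
have Le : (L%:E <= (K * 3 `^ s)%:E * \esum_(n in [set` D]) (r n `^ s)%:E)%E.
  apply: le_trans Fk _.
  apply: (@le_trans _ _ (\esum_(n in [set` D]) mu (ball (c n) (3 * r n)))).
    apply: measure_le_esum => //; first by move=> i _; exact: measurable_mball.
    move=> x [Vx [n /= nN Bx]]; apply: sD; exists n => //=.
    rewrite mem_filter mem_iota nN andbT; apply/asboolP.
    by exists x; split.
  apply: esum_le_scale.
  - by rewrite mulr_ge0 ?powR_ge0// ltW// K_gt0.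
  - by move=> n; rewrite lee_fin powR_ge0.
  - move=> n _; apply: le_trans (mu_le _ _) _; first by rewrite mulr_gt0.
    by rewrite powRM ?(ltW (r_gt0 n))// mulrA.
have -> : 2 * K ^+ 2 * 6 `^ s = (2 * K * 2 `^ s) * (K * 3 `^ s).
  have -> : (6 : R) = 2 * 3 by lra.
  by rewrite powRM//; ring.
have k0 : 0 <= 2 * K * 2 `^ s by rewrite !mulr_ge0 ?powR_ge0// ltW// K_gt0.
have -> : d `^ s = 2 * K * 2 `^ s * L.
  rewrite /L {1}(_ : d = 2 * (d / 2)); last by field.
  rewrite (powRM s) ?divr_ge0// 1?ltW//.
  by field; rewrite gt_eqF.
by rewrite EFinM [in leRHS]EFinM -muleA lee_wpmul2l// lee_fin.
Qed.

(** Disjoint balls contained in a union of dilated balls have total measure at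
    most that of the union; the growth bounds turn measures into powers of
    radii. *)
Lemma engulfed_balls_esum (c : X^nat) (r : R^nat) (D : set nat) A z rho :
  (forall n, 0 < r n) -> (forall n, D n -> r n <= 1) ->
  (forall i, A i -> 0 < rho i) ->
  trivIset D (fun n => ball (c n) (r n)) ->
  (forall n, D n -> exists2 i, A i & ball (c n) (r n) `<=` ball (z i) (7 * rho i)) ->
  (\esum_(n in D) (r n `^ s)%:E <=
     (K ^+ 2 * 7 `^ s)%:E * \esum_(i in A) (rho i `^ s)%:E)%E.
Proof.
move=> r0 r1 rho0 tD DA.
apply: (@le_trans _ _ (K%:E * \esum_(n in D) mu (ball (c n) (r n)))%E).
  apply: esum_le_scale => //; first exact: ltW.
  move=> n Dn; apply: le_trans (lee_wpmul2l _ (mu_ge (c n) (r0 n) (r1 n Dn))).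
    by rewrite -EFinM mulrA mulfV ?gt_eqF// mul1r.
  by rewrite lee_fin (ltW K_gt0).
rewrite -measure_bigcup_esum//; last by move=> i _; exact: measurable_mball.
rewrite expr2 -mulrA EFinM -muleA lee_wpmul2l ?lee_fin ?(ltW K_gt0)//.
apply: (@le_trans _ _ (\esum_(i in A) mu (ball (z i) (7 * rho i)))).
  apply: measure_le_esum.
  - exact: measurable_bigcup_balls.
  - by move=> i _; exact: measurable_mball.
  - by move=> x [n /DA[i Ai sub]] /sub; exists i.
apply: esum_le_scale.
- by rewrite mulr_ge0 ?powR_ge0// ltW// K_gt0.
- by move=> n; rewrite lee_fin powR_ge0.
- move=> i /rho0 i0; apply: le_trans (mu_le _ _) _; first by rewrite mulr_gt0.
  by rewrite powRM ?(ltW i0)// mulrA.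
Qed.

End disjoint_balls.

(** * Covers of the upper limit by balls *)

Section mass_transference.
Context {R : realType} {X : pmetricType R}.
Variables (mu : probability (borel X) R) (s K : R).
Hypotheses (s0 : 0 < s) (growth : ball_growth s K mu).
Variables (c : X^nat) (r : R^nat) (t u : R).
Hypotheses (r_gt0 : forall n, 0 < r n)
  (r_to0 : forall e, 0 < e -> exists N, forall n, (N <= n)%N -> r n < e)
  (u_gt0 : 0 < u) (u_lt : u < t) (t_le : t <= s)
  (full : mu (lim_sup_set (fun n => ball (c n) (r n `^ (t / s)))) = 1%E).
Variable (lam : R).
(* [lam_small] keeps the enlarged balls engulfed by the covering balls that touch
   a light ball below a quarter of [d `^ s]: its first factor is the constant of
   [full_limsup_disjoint_balls] and [K ^+ 2 * 7 `^ s] that of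
   [engulfed_balls_esum], applied to radii with sum of powers at most
   [(lam * d) `^ s]. *)
Hypotheses (lam_gt0 : 0 < lam)
  (lam_small : 2 * K ^+ 2 * 6 `^ s * (K ^+ 2 * 7 `^ s * lam `^ s) <= 4^-1).

Let t0 : 0 < t. Proof. exact: lt_trans u_lt. Qed.

Section cover.
Variables (A : set nat) (z : nat -> X) (rho : nat -> R).
Hypothesis rho_gt0 : forall i, A i -> 0 < rho i.

Definition touching (y : X) (d : R) : set nat :=
  A `&` [set i | ball (z i) (rho i) `&` ball y d !=set0].

Definition load (y : X) (d : R) : \bar R :=
  \esum_(i in touching y d) (rho i `^ u)%:E.

Definition light (y : X) (d : R) := (load y d < ((lam * d) `^ u)%:E)%E.

Let rhoS_ge0 p i : (0 <= (rho i `^ p)%:E)%E. Proof. by rewrite lee_fin powR_ge0. Qed.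

Lemma light_touching_le y d i : 0 < d -> light y d -> touching y d i ->
  rho i < lam * d.
Proof.
move=> d0 ly iyd; rewrite ltNge; apply/negP => di; move: ly; apply/negP.
rewrite -leNgt; apply: le_trans (esum_ge_term (rhoS_ge0 u) iyd).
by rewrite lee_fin; apply: powR_le => //; [exact: ltW|rewrite mulr_ge0// ltW].
Qed.

(** The touching balls have radius below [lam * d], so that replacing the
    exponent [u] by [s] gains a factor [(lam * d) `^ (s - u)]. *)
Lemma light_touching_mass y d : 0 < d -> light y d ->
  (\esum_(i in touching y d) (rho i `^ s)%:E <= ((lam * d) `^ s)%:E)%E.
Proof.
move=> d0 ly; have ld0 : 0 < lam * d by rewrite mulr_gt0.
have su : 0 < s - u by rewrite subr_gt0 (lt_le_trans u_lt).
apply: (@le_trans _ _ (((lam * d) `^ (s - u))%:E * load y d)%E).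
  apply: esum_le_scale => //; first exact: powR_ge0.
  move=> i iyd; have rho0 : 0 < rho i by case: iyd => /rho_gt0.
  rewrite -EFinM lee_fin (powR_split s u rho0).
  rewrite ler_wpM2r ?powR_ge0//; apply: powR_le; rewrite ?(ltW su) ?(ltW rho0)//.
  exact/ltW/(light_touching_le d0 ly).
apply: le_trans (lee_wpmul2l _ (ltW ly)) _; first by rewrite lee_fin powR_ge0.
by rewrite -EFinM lee_fin -powR_split.
Qed.

(** Otherwise every enlarged ball of the disjoint family in [ball y d] is either
    engulfed by a dilated covering ball ([big]), or contains covering balls of
    its own that carry more than their share of the load of [ball y d]. *)
Lemma light_ball_refine y d N : 0 < d -> d <= 1 -> light y d ->
  exists n, [/\ (N <= n)%N, r n <= 1, cball (c n) (r n / 2) `<=` ball y d &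
    light (c n) (r n / 2)].
Proof.
move=> d0 d1 ly; apply: contrapT => none.
have K0 : 0 < K by case: growth => K1 _ _; exact: lt_le_trans K1.
pose M := 2 * K ^+ 2 * 6 `^ s.
have M0 : 0 < M by rewrite !mulr_gt0 ?exprn_gt0 ?powR_gt0.
(* radii below [e] make the balls that are not [big] contribute at most a
   quarter of [d `^ s] *)
pose q := d `^ s / (4 * M * (2 * d) `^ u).
have d20 : 0 < 2 * d by lra.
have q0 : 0 < q by rewrite divr_gt0 ?mulr_gt0 ?powR_gt0.
pose e := Num.min 1 (q `^ (t - u)^-1).
have e0 : 0 < e by rewrite lt_min ltr01 powR_gt0.
have tu : 0 < t - u by rewrite subr_gt0.
have [e1 eq_le] : e <= 1 /\ e `^ (t - u) <= q.
  split; first by rewrite ge_min lexx.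
  rewrite -[leRHS](@powRVK _ q (t - u)) ?gt_eqF ?(ltW q0)//.
  apply: powR_le; rewrite ?(ltW tu) ?(ltW e0)//.
  by rewrite ge_min lexx orbT.
have [N1 rN1] := r_to0 e0.
pose Rt n := r n `^ (t / s).
have Rt_gt0 n : 0 < Rt n by rewrite powR_gt0.
have Rts n : Rt n `^ s = r n `^ t by rewrite /Rt -powRrM divfK ?gt_eqF.
have ts1 : t / s <= 1 by rewrite ler_pdivrMr// mul1r.
have ts0 : 0 < t / s by rewrite divr_gt0.
have Rt_to0 e' : 0 < e' -> exists N, forall n, (N <= n)%N -> Rt n < e'.
  move=> e'0; have [|N2 rN2] := r_to0 (e := e' `^ (t / s)^-1).
    by rewrite powR_gt0.
  exists N2 => n /rN2 rn.
  rewrite -[ltRHS](@powRVK _ e' (t / s)) ?gt_eqF ?(ltW e'0)//.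
  by apply: powR_lt => //; exact: ltW.
have [D [DN tD Dy dD]] := full_limsup_disjoint_balls growth y
  (maxn N N1) Rt_gt0 Rt_to0 full d0 d1.
have Dr n : D n -> r n < e.
  by move=> /DN; rewrite geq_max => /andP[_]; exact: rN1.
have Dr1 n : D n -> r n <= 1 by move=> /Dr rn; rewrite ltW// (lt_le_trans rn).
have rRt n : D n -> r n <= Rt n.
  by move=> Dn; apply: ger1_powR => //; rewrite r_gt0 Dr1.
have Rt1 n : D n -> Rt n <= 1.
  move=> Dn; rewrite -[leRHS](congr1 (@^~ (t / s)) (powR1 R)).
  by apply: powR_le; rewrite ?(ltW ts0) ?Dr1// ltW.
have half_sub n : D n -> cball (c n) (r n / 2) `<=` ball y d.
  move=> Dn x nx; apply: (Dy n Dn); rewrite in_ballE; move: nx; rewrite /cball/=.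
  by have := rRt n Dn; have := r_gt0 n; lra.
have touch_sub n : D n -> touching (c n) (r n / 2) `<=` touching y d.
  move=> Dn i [Ai [x [ix nx]]]; split => //; exists x; split => //.
  by apply: (half_sub n Dn); move: nx; rewrite in_ballE /cball/=; exact: ltW.
(* [4] leaves room for the covering balls below this size to stay inside the
   enlarged ball, and [7 = 1 + 2 + 4] is the dilation that engulfs it otherwise *)
pose big := [set n | exists2 i, touching (c n) (r n / 2) i & Rt n <= 4 * rho i].
have rhoy i : touching y d i -> 0 < rho i by case=> /rho_gt0.
have bigP : (\esum_(n in D `&` big) (Rt n `^ s)%:E <=
    (K ^+ 2 * 7 `^ s * (lam * d) `^ s)%:E)%E.
  apply: le_trans (engulfed_balls_esum growth (A := touching y d) (z := z)
    (rho := rho) Rt_gt0 _ rhoy _ _) _.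
  - by move=> n [/Rt1].
  - by apply: sub_trivIset tD => n [].
  - move=> n [Dn [i ni iR]]; exists i; first exact: touch_sub ni.
    case: ni => Ai [w []]; rewrite !in_ballE => iw nw x; rewrite !in_ballE => nx.
    have := metric_triangle (z i) w x; have := metric_triangle w (c n) x.
    by rewrite (metric_sym w (c n)); have := rRt n Dn; lra.
  rewrite [leRHS]EFinM lee_wpmul2l ?lee_fin ?mulr_ge0 ?powR_ge0 ?exprn_ge0 ?(ltW K0)//.
  exact: light_touching_mass.
have smallP : (\esum_(n in D `&` ~` big) (Rt n `^ s)%:E <=
    (e `^ (t - u) * (2 * d) `^ u)%:E)%E.
  apply: (@le_trans _ _ ((e `^ (t - u) * (2 / lam) `^ u)%:E *
      \esum_(n in D `&` ~` big) load (c n) (r n / 2))%E).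
    apply: esum_le_scale.
    + by rewrite mulr_ge0 ?powR_ge0.
    + by move=> n; apply: esum_ge0 => i _.
    + move=> n [Dn _].
      have ln : (((lam * (r n / 2)) `^ u)%:E <= load (c n) (r n / 2))%E.
        rewrite leNgt; apply/negP => ln; apply: none; exists n; split => //.
        * by move: (DN n Dn); rewrite geq_max => /andP[].
        * exact: Dr1.
        * exact: half_sub.
      apply: le_trans (lee_wpmul2l _ ln); last by rewrite lee_fin mulr_ge0 ?powR_ge0.
      rewrite Rts -EFinM lee_fin -mulrA -powRM; last 2 first.
      * by rewrite divr_ge0// ltW.
      * by rewrite mulr_ge0 ?divr_ge0// ltW.
      have -> : 2 / lam * (lam * (r n / 2)) = r n by field; rewrite gt_eqF.
      rewrite (powR_split t u (r_gt0 n)).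
      rewrite ler_wpM2r ?powR_ge0//; apply: powR_le; rewrite ?(ltW tu) ?ltW//.
      exact: Dr.
  have le_load : (\esum_(n in D `&` ~` big) load (c n) (r n / 2) <= load y d)%E.
    apply: esum_disjoint_le => //; last by move=> n [/touch_sub].
    have inB n i : (D `&` ~` big) n -> touching (c n) (r n / 2) i ->
        ball (c n) (Rt n) (z i).
      move=> [Dn nbig] ni; have : ~ (Rt n <= 4 * rho i).
        by move=> iR; apply: nbig; exists i.
      move/negP; rewrite -ltNge => iR.
      case: ni => Ai [w []]; rewrite !in_ballE => iw nw.
      have := metric_triangle (c n) w (z i); rewrite (metric_sym w (z i)).
      by have := rRt n Dn; have := Rt_gt0 n; lra.
    move=> n m nD mD [i [ni mi]]; apply: tD; [by case: nD|by case: mD|].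
    by exists (z i); split; exact: inB.
  apply: le_trans (lee_wpmul2l _ (le_trans le_load (ltW ly))) _.
    by rewrite lee_fin mulr_ge0 ?powR_ge0.
  have l2 : 0 <= 2 / lam by rewrite divr_ge0// ltW.
  have ld : 0 <= lam * d by rewrite mulr_ge0// ltW.
  rewrite -EFinM lee_fin -mulrA -powRM//.
  by have -> : 2 / lam * (lam * d) = 2 * d by field; rewrite gt_eqF.
have : ((d `^ s)%:E <= (M * (K ^+ 2 * 7 `^ s * (lam * d) `^ s +
    e `^ (t - u) * (2 * d) `^ u))%:E)%E.
  apply: le_trans dD _; rewrite [leRHS]EFinM lee_wpmul2l ?lee_fin ?(ltW M0)//.
  rewrite (esumID big)//; last by move=> n _; rewrite lee_fin powR_ge0.
  by rewrite EFinD leeD.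
rewrite lee_fin => final.
have ds0 : 0 < d `^ s by rewrite powR_gt0.
have b1 : M * (K ^+ 2 * 7 `^ s * (lam * d) `^ s) <= d `^ s / 4.
  rewrite (powRM s (ltW lam_gt0) (ltW d0)).
  have -> : M * (K ^+ 2 * 7 `^ s * (lam `^ s * d `^ s)) =
    d `^ s * (M * (K ^+ 2 * 7 `^ s * lam `^ s)) by ring.
  by rewrite ler_wpM2l// ltW.
have b2 : M * (e `^ (t - u) * (2 * d) `^ u) <= d `^ s / 4.
  rewrite mulrCA [leRHS](_ : _ = q * (M * (2 * d) `^ u)); last first.
    by rewrite /q; field; rewrite !gt_eqF ?powR_gt0.
  by rewrite ler_wpM2r// mulr_ge0 ?powR_ge0 ?(ltW M0).
lra.
Qed.

(** If the bound failed, [ball y d] would be light, and refining it forever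
    would give nested closed balls [C k].  Their common point lies in the upper limit,
    hence in some covering ball, which then touches light balls of arbitrarily
    small radius. *)
Lemma limsup_cover_mass y d : compact [set: X] -> 0 < d -> d <= 1 ->
  lim_sup_set (fun n => ball (c n) (r n)) `&` ball y d `<=`
    \bigcup_(i in A) ball (z i) (rho i) ->
  (((lam * d) `^ u)%:E <= \esum_(i in A) (rho i `^ u)%:E)%E.
Proof.
move=> cptX d0 d1 cov; rewrite leNgt; apply/negP => ltA.
have ly : light y d.
  by apply: le_lt_trans ltA; apply: esum_subset => i [].
have [n0 [_ rn0 n0y ln0]] := light_ball_refine 0 d0 d1 ly.
pose good n := r n <= 1 /\ light (c n) (r n / 2).
pose next (n m : {n | good n}) := (sval n < sval m)%N /\
  cball (c (sval m)) (r (sval m) / 2) `<=` ball (c (sval n)) (r (sval n) / 2).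
have half_gt0 n : 0 < r n / 2 by rewrite divr_gt0.
have next_ex n : {m | next n m}.
  apply: cid; case: n => n [rn ln].
  have rn2 : r n / 2 <= 1 by lra.
  have [m [nm rm sub lm]] := light_ball_refine n.+1 (half_gt0 n) rn2 ln.
  by exists (exist _ m (conj rm lm)).
have [f [f0 fnext]] := dependent_choice next_ex (exist good n0 (conj rn0 ln0)).
pose nn k := sval (f k).
pose C k := cball (c (nn k)) (r (nn k) / 2).
have nn_ge k : (k <= nn k)%N.
  elim: k => // k IHk; apply: leq_ltn_trans IHk _.
  by case: (fnext k).
have stepC k : C k.+1 `<=` ball (c (nn k)) (r (nn k) / 2) by case: (fnext k).
have nestC k j : C (k + j)%N `<=` C k.
  elim: j => [|j IHj]; first by rewrite addn0.
  rewrite addnS; apply: subset_trans IHj => w /stepC.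
  by rewrite in_ballE /C /cball/=; exact: ltW.
have [x [_ clx]] : [set: X] `&` cluster (c (nn k) @[k --> \oo]) !=set0.
  by apply: cptX; exact: filterT.
have Cx k : C k x.
  rewrite /C /cball/= leNgt; apply/negP => far.
  pose e := mdist (c (nn k)) x - r (nn k) / 2.
  have e0 : 0 < e by rewrite subr_gt0.
  have tailC : (c (nn j) @[j --> \oo]) (C k).
    exists k => // j /= kj; rewrite -(subnKC kj); apply: (@nestC k (j - k)%N).
    by rewrite /C /cball/= mdistxx; exact: ltW.
  have [w [Cw]] := clx _ _ tailC (nbhsx_ballx x e e0).
  rewrite in_ballE; move: Cw; rewrite /C /cball/= => Cw xw.
  have := metric_triangle (c (nn k)) w x; rewrite (metric_sym w x).
  by rewrite /e in xw; lra.
have [|i Ai xi] := cov x.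
  split; last by apply: n0y; have := Cx 0%N; rewrite /C /nn f0.
  move=> k _; exists (nn k); first exact: nn_ge.
  rewrite in_ballE; have := Cx k; rewrite /C /cball/=; have := r_gt0 (nn k); lra.
have rhoi := rho_gt0 Ai.
have [|N rN] := r_to0 (e := 2 * rho i / lam).
  by rewrite divr_gt0// mulr_gt0.
have [_ lN] := proj2_sig (f N).
have : rho i < lam * (r (nn N) / 2).
  apply: light_touching_le lN _ => //; split => //; exists x; split => //.
  exact: stepC.
have := rN _ (nn_ge N); rewrite ltr_pdivlMr//; lra.
Qed.

End cover.

End mass_transference.

(** * Dyadic cubes and the Hausdorff dimension of the space *)

Lemma inner_const (R : realType) (b : R) : 0 < b -> b < 1 / 3 ->
  0 < 1 / 2 - b / (1 - b) <= 1.
Proof.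
move=> b0 b3; have b1 : 0 < 1 - b by lra.
have : b / (1 - b) < 1 / 2 by rewrite ltr_pdivrMr//; lra.
have : 0 < b / (1 - b) by rewrite divr_gt0.
by move=> h1 h2; apply/andP; split; lra.
Qed.

Lemma outer_const (R : realType) (b : R) : b < 1 / 3 -> 0 < 1 / (1 - b).
Proof. by move=> b3; rewrite divr_gt0//; lra. Qed.

Section dimension.
Context {R : realType} {X : pmetricType R}.
Variables (mu : probability (borel X) R) (s K : R).
Hypotheses (s0 : 0 < s) (growth : ball_growth s K mu).
Implicit Types (x y z : X).

Let K0 : 0 < K. Proof. by case: growth => K1 _ _; exact: lt_le_trans K1. Qed.
Let mu_le x r : 0 < r -> (mu (ball x r) <= (K * r `^ s)%:E)%E.
Proof. by case: growth => _ + _; apply. Qed.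
Let mu_ge x r : 0 < r -> r <= 1 -> ((K^-1 * r `^ s)%:E <= mu (ball x r))%E.
Proof. by case: growth => _ _; apply. Qed.

Lemma measurable_cball x d : measurable (cball x d : set (borel X)).
Proof.
rewrite -(setCK (cball x d)); apply: (@measurableC _ (borel X)).
apply: sub_sigma_algebra; rewrite openE => y /=.
rewrite /cball/= => /negP; rewrite -ltNge => dy; apply/nbhs_ballP.
exists (mdist x y - d) => /=; first by rewrite subr_gt0.
move=> z; rewrite in_ballE /= => yz; apply/negP; rewrite -ltNge.
have := metric_triangle x z y; rewrite (metric_sym z y); lra.
Qed.

(** The factor 2 absorbs the boundary when [d > 0]; for [d = 0] the bound says
    that points are null, which follows from small balls being small. *)
Lemma mu_cball_le x d : 0 <= d -> (mu (cball x d) <= (K * (2 * d) `^ s)%:E)%E.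
Proof.
have cball_sub e : d < e -> (mu (cball x d) <= (K * e `^ s)%:E)%E.
  move=> de; have [d0|d0] := leP 0 d; last first.
    rewrite (_ : cball x d = set0) ?measure0 ?lee_fin ?mulr_ge0 ?powR_ge0 ?(ltW K0)//.
    apply/seteqP; split => // y; rewrite /cball/= => xy.
    by have := mdist_ge0 x y; lra.
  apply: le_trans (mu_le x (le_lt_trans d0 de)).
  apply: le_measure; rewrite ?inE; [exact: measurable_cball|exact: measurable_mball|].
  by move=> y; rewrite in_ballE /cball/=; lra.
rewrite le_eqVlt => /predU1P[d0|d0]; last by apply: cball_sub; lra.
rewrite -d0 mulr0 powR0 ?gt_eqF// mulr0; apply/lee_addgt0Pr => e e0; rewrite add0e.
have eK : 0 < e / K by rewrite divr_gt0.
have -> : e = K * ((e / K) `^ s^-1) `^ s.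
  by rewrite powRVK ?gt_eqF ?(ltW eK)// mulrC divfK ?gt_eqF.
by rewrite d0; apply: cball_sub; rewrite -d0 powR_gt0.
Qed.

(** Mass distribution: each set of a cover lies in a closed ball of radius its
    diameter, of measure at most a constant times the diameter to the power
    [s].  Diameters up to [2^-1] make this at most the power [p]. *)
Lemma hausdorff_measure_gt0 p : 0 < p -> p <= s ->
  (0 < hausdorff_measure p [set: X])%E.
Proof.
move=> p0 ps; have Kp : 0 < K * 2 `^ p by rewrite mulr_gt0// powR_gt0.
apply: (@lt_le_trans _ _ (K * 2 `^ p)^-1%:E); first by rewrite lte_fin invr_gt0.
apply: (@le_trans _ _ (hausdorff_premeasure p 2^-1 [set: X])); last first.
  by apply: ereal_sup_ubound; exists 2^-1 => //=; rewrite invr_gt0.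
apply/ereal_infP => _ [U [covU diamU] <-].
rewrite -[leLHS]mule1 lee_pdivrMl//.
have diam_ge0 i : (0 <= diam (U i))%E by apply: ereal_sup_ubound; left.
pose dd i := fine (diam (U i)).
have diamE i : diam (U i) = (dd i)%:E.
  rewrite /dd fineK// ge0_fin_numE//; apply: le_lt_trans (diamU i) _.
  exact: ltry.
(* the empty set when [U i] is empty, and otherwise a closed ball around a chosen
   point of [U i]; unlike [U i] it is measurable *)
pose V i := [set y | exists2 x, xget point (U i) = x /\ U i x & cball x (dd i) y].
have VE i : V i = set0 \/ V i = cball (xget point (U i)) (dd i).
  have [[x Ux]|] := pselect (U i !=set0).
    right; apply/seteqP; split => y; first by move=> [_ [<- _]].
    by exists (xget point (U i)) => //; split => //; exact: xgetPex (ex_intro _ x Ux).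
  move=> Ui; left; apply/seteqP; split => // y [x [_ Ux]].
  by exfalso; apply: Ui; exists x.
have mV i : measurable (V i : set (borel X)).
  case: (VE i) => ->; first exact: measurable0.
  exact: measurable_cball.
have UV i : U i `<=` V i.
  move=> y Uy; have Ux := xgetPex point (ex_intro _ y Uy).
  exists (xget point (U i)) => //.
  by rewrite /cball/= -lee_fin -diamE; exact: mdist_le_diam.
rewrite -(probability_setT mu).
apply: le_trans (measure_sigma_subadditive mu mV measurableT _) _.
  by move=> x /covU[i _ Ux]; exists i => //; exact: UV.
rewrite -nneseriesZl//; last by move=> i _; exact: poweR_ge0.
apply: lee_nneseries => // i _.
rewrite diamE poweR_EFin -EFinM -mulrA.
have d0 : 0 <= dd i by rewrite -lee_fin -diamE.
rewrite -powRM//.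
apply: (@le_trans _ _ (K * (2 * dd i) `^ s)%:E).
  case: (VE i) => ->; last exact: mu_cball_le.
  by rewrite measure0 lee_fin mulr_ge0 ?powR_ge0// ltW.
rewrite lee_fin ler_wpM2l ?(ltW K0)//.
have dle : 2 * dd i <= 1.
  by have := diamU i; rewrite diamE lee_fin; lra.
have [d00|dn0] := eqVneq (dd i) 0.
  by rewrite d00 mulr0 !powR0 ?gt_eqF.
by apply: ger_powR => //; rewrite dle andbT lt_neqAle eq_sym
  mulf_neq0// mulr_ge0.
Qed.

Section cubes.
Variables (b : R) (I : int -> set nat) (Q : int -> nat -> set X)
  (xQ : int -> nat -> X).
Hypotheses (b0 : 0 < b) (b3 : b < 1 / 3) (dyadic : dyadic_cubes b I Q xQ).

Let c_in := 1 / 2 - b / (1 - b).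
Let c_out := 1 / (1 - b).

Let c_in0 : 0 < c_in. Proof. by case/andP: (inner_const b0 b3). Qed.
Let c_in1 : c_in <= 1. Proof. by case/andP: (inner_const b0 b3). Qed.
Let c_out0 : 0 < c_out. Proof. exact: outer_const. Qed.
Let b_lt1 : b < 1.
Proof. by apply: lt_trans b3 _; rewrite mul1r invf_lt1// ltr1n. Qed.

Lemma expb_small e : 0 < e -> exists N, forall n, (N <= n)%N -> b ^+ n < e.
Proof.
move=> e0; have b1 : `|b| < 1 by rewrite gtr0_norm.
have /cvgrPdist_lt/(_ e e0)[N _ NP] := cvg_expr b1.
exists N => n /NP/=; by rewrite sub0r normrN gtr0_norm// exprn_gt0.
Qed.

Lemma expb_gt0 n : 0 < b ^+ n. Proof. by rewrite exprn_gt0. Qed.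
Lemma expb_le1 n : b ^+ n <= 1. Proof. by rewrite exprn_ile1// ltW. Qed.

Lemma cube_inner (n : nat) i : I n i -> ball (xQ n i) (c_in * b ^+ n) `<=` Q n i.
Proof. by move=> /(dyadic_inner dyadic); rewrite -exprnP. Qed.

Lemma cube_outer (n : nat) i : I n i -> Q n i `<=` cball (xQ n i) (c_out * b ^+ n).
Proof. by move=> /(dyadic_outer dyadic); rewrite -exprnP. Qed.

Lemma cube_mass_ge (n : nat) i : I n i ->
  ((K^-1 * (c_in * b ^+ n) `^ s)%:E <= mu (Q n i))%E.
Proof.
move=> Ii; apply: le_trans (mu_ge (xQ n i) _ _) _.
- by rewrite mulr_gt0// expb_gt0.
- by rewrite mulr_ile1 ?expb_le1 ?(ltW c_in0) ?(ltW (expb_gt0 _)).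
apply: le_measure; rewrite ?inE; [exact: measurable_mball|exact: (dyadic_borel dyadic)|].
exact: cube_inner.
Qed.

Lemma cube_mass_le (n : nat) i : I n i ->
  (mu (Q n i) <= (K * (2 * (c_out * b ^+ n)) `^ s)%:E)%E.
Proof.
move=> Ii; apply: le_trans (mu_cball_le (xQ n i) _); last first.
  by rewrite mulr_ge0 ?(ltW c_out0) ?(ltW (expb_gt0 _)).
apply: le_measure; rewrite ?inE; [exact: (dyadic_borel dyadic)|exact: measurable_cball|].
exact: cube_outer.
Qed.

Lemma cube_mass_sum (n : nat) : \esum_(i in I n) mu (Q n i) = 1%E.
Proof.
rewrite -measure_bigcup_esum; [|by move=> i; exact: (dyadic_borel dyadic)|].
  by rewrite (dyadic_cover dyadic); exact: probability_setT.
exact: (dyadic_disjoint dyadic).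
Qed.

(** Cover by the cubes of generation [n]: the power [p] of the diameter of a cube
    is at most [H * (b ^+ n) `^ (p - s)] times its measure, and the measures add
    up to 1. *)
Lemma hausdorff_measure_eq0 p : s < p -> hausdorff_measure p [set: X] = 0%E.
Proof.
move=> sp; have ps : 0 < p - s by rewrite subr_gt0.
have p0 : 0 < p by exact: lt_trans sp.
apply/eqP; rewrite eq_le; apply/andP; split; last first.
  apply: le_trans (_ : (0 <= hausdorff_premeasure p 1 [set: X])%E) _.
    apply/ereal_infP => _ [U _ <-]; apply: nneseries_ge0 => i _ _.
    exact: poweR_ge0.
  by apply: ereal_sup_ubound; exists 1 => //=.
apply/ereal_supP => _ [d /= d0 <-]; apply/lee_addgt0Pr => e e0; rewrite add0e.
pose H := (2 * c_out) `^ p * (K * (c_in `^ s)^-1).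
have H0 : 0 < H by rewrite !mulr_gt0 ?invr_gt0 ?powR_gt0// mulr_gt0.
have [|N1 N1P] := expb_small (e := d / (2 * c_out)).
  by rewrite divr_gt0// mulr_gt0.
have eH : 0 < e / H by rewrite divr_gt0.
have [|N2 N2P] := expb_small (e := (e / H) `^ (p - s)^-1).
  by rewrite powR_gt0.
pose n := maxn N1 N2.
have be : b ^+ n < d / (2 * c_out) by apply: N1P; exact: leq_maxl.
have bH : (b ^+ n) `^ (p - s) <= e / H.
  rewrite -[leRHS](@powRVK _ (e / H) (p - s)) ?gt_eqF ?(ltW eH)//.
  apply: powR_le; rewrite ?(ltW ps) ?(ltW (expb_gt0 _))//.
  by apply/ltW/N2P; exact: leq_maxr.
pose U i := if i \in I n then Q n i else set0.
have diam0 : diam (set0 : set X) = 0%E.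
  apply/le_anti/andP; split; last by apply: ereal_sup_ubound; left.
  by apply: (@diam_le _ _ set0 0).
have c2 : 0 <= 2 * (c_out * b ^+ n).
  by rewrite mulr_ge0// mulr_ge0 ?(ltW c_out0) ?(ltW (expb_gt0 _)).
have diamQ i : I n i -> (diam (Q n i) <= (2 * (c_out * b ^+ n))%:E)%E.
  move=> Ii; apply: diam_le => // x y /(cube_outer Ii) + /(cube_outer Ii).
  rewrite /cball/=; have := metric_triangle x (xQ n i) y.
  rewrite (metric_sym x (xQ n i)); lra.
apply: ge_ereal_inf; exists (\sum_(i <oo) diam (U i) `^ p)%E.
  exists U => //; split => [x _|i].
    have [i Ii Qx] : (\bigcup_(i in I n) Q n i) x by rewrite (dyadic_cover dyadic).
    by exists i => //; rewrite /U mem_set.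
  rewrite /U; case: ifPn => [/set_mem Ii|_]; last by rewrite diam0 lee_fin ltW.
  apply: le_trans (diamQ i Ii) _; rewrite lee_fin.
  have c20 : 0 < 2 * c_out by rewrite mulr_gt0.
  by move: be; rewrite (ltr_pdivlMr _ _ c20) mulrCA [c_out * _]mulrC => /ltW.
rewrite nneseries_esumT; last by move=> i; exact: poweR_ge0.
apply: (@le_trans _ _ (\esum_(i in I n) diam (Q n i) `^ p)%E).
  rewrite [leRHS]esum_mkcond; apply: le_esum => i _; rewrite /U; case: ifPn => // _.
  by rewrite diam0 poweR0r// gt_eqF.
apply: (@le_trans _ _ ((H * (b ^+ n) `^ (p - s))%:E *
    \esum_(i in I n) mu (Q n i))%E); last first.
  rewrite cube_mass_sum mule1 lee_fin.
  by move: bH; rewrite ler_pdivlMr// mulrC.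
apply: esum_le_scale => [|//|i Ii]; first by rewrite mulr_ge0 ?powR_ge0// ltW.
apply: (@le_trans _ _ ((2 * (c_out * b ^+ n)) `^ p)%:E).
  rewrite -poweR_EFin; apply: gt0_ler_poweR.
  - exact: ltW.
  - by rewrite in_itv/= leey andbT; apply: ereal_sup_ubound; left.
  - by rewrite in_itv/= leey andbT lee_fin.
  - exact: diamQ.
apply: le_trans (lee_wpmul2l _ (cube_mass_ge Ii)); last first.
  by rewrite lee_fin mulr_ge0 ?powR_ge0// ltW.
rewrite -EFinM lee_fin mulrA (powRM p) ?(ltW (expb_gt0 _))//; last first.
  by rewrite mulr_ge0// ltW.
rewrite (powRM s (ltW c_in0) (ltW (expb_gt0 _))) (powR_split p s (expb_gt0 n)) /H.
rewrite le_eqVlt; apply/orP; left; apply/eqP; field.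
by rewrite !gt_eqF ?powR_gt0.
Qed.

Lemma hausdorff_dim_space : hausdorff_dim [set: X] = s%:E.
Proof.
apply/eqP; rewrite eq_le; apply/andP; split.
  apply/lee_addgt0Pr => e e0; apply: ereal_inf_lbound; exists (s + e) => //.
  by split; [exact: addr_gt0|apply: hausdorff_measure_eq0; rewrite ltrDl].
apply/ereal_infP => _ [p [p0 Hp] <-]; rewrite lee_fin leNgt; apply/negP => ps.
by have := hausdorff_measure_gt0 p0 (ltW ps); rewrite Hp ltxx.
Qed.

End cubes.
End dimension.

(** * The net content of a set satisfying the bound for ball covers *)

Section net_content_of_massive_sets.
Context {R : realType} {X : pmetricType R}.
Variables (mu : probability (borel X) R) (s K : R).
Hypotheses (s0 : 0 < s) (growth : ball_growth s K mu).
Variables (b : R) (I : int -> set nat) (Q : int -> nat -> set X)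
  (xQ : int -> nat -> X).
Hypotheses (b0 : 0 < b) (b3 : b < 1 / 3) (dyadic : dyadic_cubes b I Q xQ).
Variables (F : set X) (u lam : R).
Hypotheses (u_gt0 : 0 < u) (u_lt : u < s) (lam_gt0 : 0 < lam).
Hypothesis massive : forall (A : set nat) (z : nat -> X) (rho : nat -> R) y d,
  (forall i, A i -> 0 < rho i) -> 0 < d -> d <= 1 ->
  F `&` ball y d `<=` \bigcup_(i in A) ball (z i) (rho i) ->
  (((lam * d) `^ u)%:E <= \esum_(i in A) (rho i `^ u)%:E)%E.

Let K0 : 0 < K. Proof. by case: growth => K1 _ _; exact: lt_le_trans K1. Qed.

Lemma cubes_measurable (A : set X) : cubes I Q A -> measurable (A : set (borel X)).
Proof.
move=> [n _]; rewrite /cube_generation; case: ifPn => _.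
  by move=> ->; exact: measurableT.
by move=> [i Ii <-]; exact: dyadic_borel dyadic _ _ Ii.
Qed.

Lemma cubes_nested (A : set X) : cubes I Q A ->
  exists n0, forall n j, (n0 <= n)%N -> I n%:Z j -> Q n%:Z j `&` A !=set0 ->
    Q n%:Z j `<=` A.
Proof.
move=> [m _]; rewrite /cube_generation; case: ifPn => [_ ->|_ [i Ii <-]].
  by exists 0%N.
exists m => n j mn Ij /set0P/eqP nm.
by case: (@dyadic_nested _ _ _ _ _ _ dyadic m n j i) => //; rewrite lez_nat.
Qed.

(** The constants lost in [massive] are compensated by cutting [A0] into cubes of
    a very fine generation and using that [u < s]. *)
Lemma cube_mass_le_cover (A0 : set X) (D : set nat) (C : nat -> set X) :
  cubes I Q A0 -> (forall i, D i -> cubes I Q (C i)) ->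
  F `&` A0 `<=` \bigcup_(i in D) C i ->
  (mu A0 `^ (u / s) <= \esum_(i in D) mu (C i) `^ (u / s))%E.
Proof.
move=> cA0 cC cov; rewrite leNgt; apply/negP => light.
set a := u / s in light *; set S := (\esum_(i in D) _)%E in light.
have a0 : 0 < a by rewrite divr_gt0.
have a1 : a < 1 by rewrite ltr_pdivrMr// mul1r.
have mA0 := cubes_measurable cA0.
have mC i : D i -> measurable (C i : set (borel X)) by move=> /cC/cubes_measurable.
pose m (A : set X) := fine (mu A).
have muE A : measurable (A : set (borel X)) -> mu A = (m A)%:E.
  by move=> mA; rewrite /m fineK//; exact: fin_num_measure.
have m_ge0 A : 0 <= m A by rewrite fine_ge0.
have m_le1 A : measurable (A : set (borel X)) -> m A <= 1.
  by move=> mA; rewrite -lee_fin -muE//; exact: probability_le1.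
have S_ge0 : (0 <= S)%E by apply: esum_ge0 => i _; exact: poweR_ge0.
move: light; rewrite (muE A0)// poweR_EFin => light.
have SE : S = (fine S)%:E.
  by rewrite fineK// ge0_fin_numE// (lt_le_trans light)// leey.
have lightR : fine S < m A0 `^ a by rewrite -lte_fin -SE.
have A0_gt0 : 0 < m A0.
  rewrite lt_neqAle m_ge0 andbT eq_sym; apply/eqP => m0.
  move: lightR; rewrite m0 powR0 ?gt_eqF// ltNge => /negP; apply.
  by rewrite fine_ge0.
have CS i : D i -> m (C i) `^ a <= fine S.
  move=> Di; rewrite -lee_fin -SE -poweR_EFin -muE; last exact: mC.
  by apply: (esum_ge_term (f := fun i => mu (C i) `^ a)%E) => // j; exact: poweR_ge0.
have C_lt i : D i -> m (C i) < m A0.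
  move=> Di; rewrite ltNge; apply/negP => A0C.
  have := CS i Di; apply/negP; rewrite -ltNge (lt_le_trans lightR)//.
  by apply: powR_le => //; exact: ltW.
(* none of the [C i] is the whole space, whose measure is 1, so that all of them
   come from the dyadic structure *)
have C_dyadic i : exists p : nat * nat,
    D i -> I p.1%:Z p.2 /\ C i = Q p.1%:Z p.2.
  have [Di|nDi] := pselect (D i); last by exists (0, 0)%N.
  have [n _] := cC i Di; rewrite /cube_generation; case: ifPn => _.
    move=> CT; have := C_lt i Di; rewrite CT ltNge => /negP h; exfalso; apply: h.
    rewrite (_ : m setT = 1); first exact: m_le1.
    by rewrite /m (probability_setT mu).
  by move=> [j Ij Qj]; exists (n, j).
have [p pP] := choice C_dyadic.
have C_gt0 i : D i -> 0 < m (C i).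
  move=> Di; have [Ip CE] := pP i Di; rewrite -lte_fin -muE; last exact: mC.
  rewrite CE; apply: lt_le_trans (cube_mass_ge growth b0 b3 dyadic Ip).
  have [ci _] := andP (inner_const b0 b3).
  by rewrite lte_fin mulr_gt0 ?invr_gt0 ?powR_gt0 ?mulr_gt0 ?exprn_gt0.
pose W := \bigcup_(i in D) C i.
have mW : measurable (W : set (borel X)) by exact: bigcup_measurable.
pose E := A0 `\` W.
have mE : measurable (E : set (borel X)) by exact: measurableD.
have E_gt0 : 0 < m E.
  have mAW : measurable (A0 `&` W : set (borel X)) by exact: measurableI.
  have AW : m (A0 `&` W) <= m A0 `^ (1 - a) * fine S.
    rewrite -lee_fin -muE// EFinM -SE.
    apply: (@le_trans _ _ (\esum_(i in D) mu (C i))).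
      by apply: measure_le_esum => // x [].
    apply: esum_le_scale => [|i|i Di]; [exact: powR_ge0|exact: poweR_ge0|].
    rewrite muE; last exact: mC.
    rewrite poweR_EFin -EFinM lee_fin -{1}(powRr1 (m_ge0 (C i))).
    rewrite (powR_split 1 a (C_gt0 i Di)) ler_wpM2r ?powR_ge0//.
    by apply: powR_le; rewrite ?subr_ge0 ?(ltW a1)//; exact/ltW/C_lt.
  have AE : m A0 = m E + m (A0 `&` W).
    apply: EFin_inj; rewrite EFinD -!muE//; exact: (measureDI mu mA0 mW).
  have : m A0 `^ (1 - a) * fine S < m A0.
    rewrite -[ltRHS](powRr1 (m_ge0 A0)) (powR_split 1 a A0_gt0).
    by rewrite ltr_pM2l// powR_gt0.
  by move=> h; rewrite -(ltrD2r (m (A0 `&` W))) add0r -AE (le_lt_trans AW).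
set ci := 1 / 2 - b / (1 - b).
have ci0 : 0 < ci by case/andP: (inner_const b0 b3).
have ci1 : ci <= 1 by case/andP: (inner_const b0 b3).
set co := 1 / (1 - b).
have co0 : 0 < co by exact: outer_const.
have bn0 n : 0 < b ^+ n by exact: exprn_gt0.
(* [C i] lies in the open ball of this radius around its centre *)
pose rho i := 2 * (co * b ^+ (p i).1).
have rho0 i : 0 < rho i by rewrite /rho mulr_gt0// mulr_gt0.
pose H := K `^ a * (2 * co / ci) `^ u.
have H0 : 0 < H by rewrite mulr_gt0 ?powR_gt0// divr_gt0// mulr_gt0.
have rhoC i : D i -> ((rho i `^ u)%:E <= H%:E * mu (C i) `^ a)%E.
  move=> Di; have [Ip CE] := pP i Di.
  rewrite muE; last exact: mC.
  rewrite poweR_EFin -EFinM lee_fin.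
  have cb0 : 0 < ci * b ^+ (p i).1 by rewrite mulr_gt0.
  apply: (@le_trans _ _ (H * (K^-1 * (ci * b ^+ (p i).1) `^ s) `^ a)); last first.
    rewrite ler_wpM2l ?(ltW H0)//; apply: powR_le.
    - exact: ltW.
    - by rewrite mulr_ge0 ?powR_ge0 ?invr_ge0 ?(ltW K0).
    - by rewrite -lee_fin -muE ?CE; [|exact: (dyadic_borel dyadic)];
        exact: (cube_mass_ge growth b0 b3 dyadic Ip).
  rewrite (@powRM _ K^-1 (_ `^ s) a) ?powR_ge0 ?invr_ge0 ?(ltW K0)// -powRrM.
  have -> : s * a = u by rewrite /a mulrC divfK ?gt_eqF.
  rewrite /H mulrACA -(@powRM _ K) ?invr_ge0 ?(ltW K0)// mulfV ?gt_eqF// powR1 mul1r.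
  rewrite -(@powRM _ (2 * co / ci)) ?(ltW cb0)//; last first.
    by rewrite ltW// divr_gt0// mulr_gt0.
  rewrite le_eqVlt; apply/orP; left; apply/eqP; congr (_ `^ u); rewrite /rho.
  by field; rewrite gt_eqF.
pose G := K * (2 * co) `^ s / (lam * ci) `^ u.
have co2 : 0 < 2 * co by rewrite mulr_gt0.
have lci0 : 0 < lam * ci by rewrite mulr_gt0.
have G0 : 0 < G by rewrite divr_gt0 ?powR_gt0// mulr_gt0 ?powR_gt0.
have [n0 nested0] := cubes_nested cA0.
have small N : (n0 <= N)%N -> m E <= G * H * (b ^+ N) `^ (s - u) * fine S.
  move=> n0N.
  (* the cubes of generation [N] that meet [E], and the covering cubes that meet
     each of them *)
  pose J := [set j | I N%:Z j /\ Q N%:Z j `&` E !=set0].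
  pose Dj j := D `&` [set i | C i `&` Q N%:Z j !=set0].
  have lN0 : 0 < lam * (ci * b ^+ N) by rewrite mulr_gt0// mulr_gt0.
  have C_sub i j : J j -> Dj j i -> C i `<=` Q N%:Z j.
    move=> [Ij [e [Qe [A0e nWe]]]] [Di [w [Cw Qw]]].
    have [Ip CE] := pP i Di.
    have [gN|Ng] := leqP (p i).1 N.
      case: (@dyadic_nested _ _ _ _ _ _ dyadic (p i).1%:Z N%:Z j (p i).2) => //.
        by rewrite -CE => /seteqP[+ _] => /(_ w); case.
      by rewrite -CE => sub; exfalso; apply: nWe; exists i => //; exact: sub.
    case: (@dyadic_nested _ _ _ _ _ _ dyadic N%:Z (p i).1%:Z (p i).2 j) => //.
    - by rewrite lez_nat ltnW.
    - by rewrite -CE => /seteqP[+ _] => /(_ w); case.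
    - by rewrite -CE.
  have tDj : trivIset J Dj.
    move=> j k Jj Jk [i [ij ik]].
    have [w Cw] : C i !=set0.
      by case: ij => _ [w [Cw _]]; exists w.
    apply: (dyadic_disjoint dyadic (n := N%:Z)) => //; [by case: Jj|by case: Jk|].
    by exists w; split; [exact: (C_sub i j)|exact: (C_sub i k)].
  rewrite -lee_fin -muE// EFinM -SE.
  apply: (@le_trans _ _ (\esum_(j in J) mu (Q N%:Z j))).
    apply: measure_le_esum => //; first by move=> j [Ij _]; exact: (dyadic_borel dyadic).
    move=> x Ex; have [j Ij Qx] : (\bigcup_(j in I N%:Z) Q N%:Z j) x.
      by rewrite (dyadic_cover dyadic).
    by exists j => //; split => //; exists x.
  apply: (@le_trans _ _ ((G * H * (b ^+ N) `^ (s - u))%:E *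
      \esum_(j in J) \esum_(i in Dj j) mu (C i) `^ a)%E); last first.
    apply: lee_wpmul2l; first by rewrite lee_fin mulr_ge0 ?powR_ge0// mulr_ge0// ltW.
    apply: (esum_disjoint_le (f := fun i => mu (C i) `^ a)%E) => //.
      by move=> j _ i [].
    by move=> i; exact: poweR_ge0.
  apply: esum_le_scale => [|j|j Jj].
  - by rewrite mulr_ge0 ?powR_ge0// mulr_ge0// ltW.
  - by apply: esum_ge0 => i _; exact: poweR_ge0.
  have [Ij [e [Qe [A0e _]]]] := Jj.
  apply: le_trans (cube_mass_le s0 growth b0 b3 dyadic Ij) _.
  have -> : K * (2 * (1 / (1 - b) * b ^+ N)) `^ s =
      (G * (b ^+ N) `^ (s - u)) * (lam * (ci * b ^+ N)) `^ u.
    rewrite -/co [in LHS]mulrA [in RHS](mulrA lam).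
    rewrite (powRM s (ltW co2) (ltW (bn0 N))) (powRM u (ltW lci0) (ltW (bn0 N))).
    rewrite (powR_split s u (bn0 N)) /G; field.
    by rewrite gt_eqF ?powR_gt0.
  have bound : (((lam * (ci * b ^+ N)) `^ u)%:E <=
      H%:E * \esum_(i in Dj j) mu (C i) `^ a)%E.
    apply: le_trans (_ : (_ <= \esum_(i in Dj j) (rho i `^ u)%:E)%E) _.
      apply: (massive (z := fun i => xQ (p i).1%:Z (p i).2) (y := xQ N%:Z j)) => //.
      - by rewrite mulr_gt0.
      - by rewrite mulr_ile1 ?(ltW ci0) ?(ltW (bn0 _))// (expb_le1 b0 b3).
      move=> x [Fx xj]; have Qx := cube_inner dyadic Ij xj.
      have [|i Di Cx] := cov x.
        by split => //; apply: (nested0 N j) Qx => //; exists e.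
      exists i; first by split => //; exists x.
      have [Ip CE] := pP i Di; move: Cx; rewrite CE => /(cube_outer dyadic Ip).
      rewrite in_ballE /cball/= -/co /rho => h.
      by apply: (le_lt_trans h); rewrite (ltr_pMl _ (mulr_gt0 co0 (bn0 _))) ltr1n.
    apply: esum_le_scale => [|i|i []]; [exact: ltW|exact: poweR_ge0|].
    by move=> Di _; exact: rhoC.
  rewrite EFinM; apply: le_trans (lee_wpmul2l _ bound) _.
    by rewrite lee_fin mulr_ge0 ?powR_ge0// ltW.
  by rewrite muleA -EFinM mulrAC.
have su : 0 < s - u by rewrite subr_gt0.
(* [+ 1] only keeps the denominator positive *)
pose T := G * H * fine S + 1.
have T0 : 0 < T by rewrite ltr_wpDl// mulr_ge0 ?fine_ge0// mulr_ge0// ltW.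
have ET : 0 < m E / T by rewrite divr_gt0.
have [|N1 N1P] := expb_small b0 b3 (e := (m E / T) `^ (s - u)^-1).
  by rewrite powR_gt0.
have := small (maxn n0 N1) (leq_maxl _ _); apply/negP; rewrite -ltNge.
set N := maxn n0 N1; set q := (b ^+ N) `^ (s - u).
have qlt : q < m E / T.
  rewrite -[ltRHS](@powRVK _ (m E / T) (s - u)) ?gt_eqF ?(ltW ET)//.
  by apply: powR_lt => //; [exact: ltW|apply: N1P; exact: leq_maxr].
have q0 : 0 < q by rewrite powR_gt0.
move: qlt; rewrite ltr_pdivlMr// => /(lt_trans _); apply.
rewrite /T mulrDr mulr1 mulrAC mulrC.
by rewrite ltrDl.
Qed.

Lemma net_content_massive (A0 : set X) : cubes I Q A0 ->
  net_content mu I Q u (F `&` A0) = net_content mu I Q u A0.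
Proof.
move=> cA0; rewrite /net_content (hausdorff_dim_space s0 growth b0 b3 dyadic) /=.
apply/le_anti/andP; split.
  apply: ereal_inf_le_tmp => _ [DA [cDA sub] <-]; exists DA => //; split => //.
  by move=> x [_ /sub].
apply: (@le_trans _ _ (mu A0 `^ (u / s))%E).
  apply: ereal_inf_lbound; exists ([set 0%N], fun=> A0) => /=.
    by split => // x A0x; exists 0%N.
  by rewrite esum_set1//; exact: poweR_ge0.
apply/ereal_infP => _ [[D C] [/= cC cov] <-].
exact: cube_mass_le_cover.
Qed.

End net_content_of_massive_sets.

Theorem corollary1p2 (R : realType) (X : pmetricType R) (s : R)
    (mu : probability (borel X) R)
    (b : R) (I : int -> set nat) (Q : int -> nat -> set X) (xQ : int -> nat -> X)
    (c : X^nat) (r : R^nat) (t : R)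
    (s_gt0 : 0 < s)
    (compactX : compact [set: X])
    (mu_regular : ahlfors_regular s mu)
    (b_gt0 : 0 < b) (b_lt : b < 1 / 3)
    (Q_dyadic : dyadic_cubes b I Q xQ)
    (r_gt0 : forall n, 0 < r n)
    (diam_decr : nonincreasing_seq (fun n => diam (ball (c n) (r n))))
    (diam_to0 : diam (ball (c n) (r n)) @[n --> \oo] --> 0%E)
    (t_gt0 : 0 < t) (t_le : t <= s)
    (full : mu (lim_sup_set (fun n => ball (c n) (r n `^ (t / s)))) = 1%E) :
  large_intersection_class mu I Q t (lim_sup_set (fun n => ball (c n) (r n))).
Proof.
split.
  exists (fun n => \bigcup_(j in [set j | (n <= j)%N]) ball (c j) (r j)) => //.
  by move=> n; apply: bigcup_open => j _; exact: open_mball.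
move=> u A u_gt0 u_lt cA.
(* In a one-point space the dimension is 0 rather than [s], but there the upper
   limit is the whole space. *)
have [[[x y] /= xy]|single] := pselect (exists p : X * X, p.1 != p.2); last first.
  rewrite (_ : lim_sup_set _ = setT) ?setTI//.
  apply/seteqP; split => // x _ n _; exists n => //=.
  have -> : x = c n.
    by apply/eqP/negPn/negP => xc; apply: single; exists (x, c n).
  exact: ballxx.
have [K growth] := ahlfors_ball_growth s_gt0 xy mu_regular.
have K0 : 0 < K by case: growth => K1 _ _; exact: lt_le_trans K1.
have r_to0 := radius_to0 s_gt0 growth diam_to0.
pose M := 2 * K ^+ 2 * 6 `^ s * (K ^+ 2 * 7 `^ s).
have M0 : 0 < M by rewrite !mulr_gt0 ?exprn_gt0 ?powR_gt0.
pose lam := ((4 * M)^-1) `^ s^-1.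
have lam0 : 0 < lam by rewrite powR_gt0// invr_gt0 mulr_gt0.
have lam_small : 2 * K ^+ 2 * 6 `^ s * (K ^+ 2 * 7 `^ s * lam `^ s) <= 4^-1.
  have -> : lam `^ s = (4 * M)^-1.
    by rewrite powRVK ?gt_eqF// invr_ge0 mulr_ge0// ltW.
  by rewrite mulrA -/M invfM mulrCA mulfV ?mulr1// gt_eqF.
apply: (net_content_massive s_gt0 growth b_gt0 b_lt Q_dyadic u_gt0 _ lam0) => //.
  exact: lt_le_trans t_le.
move=> D z rho y' d rho0 d0 d1 cov.
exact: (limsup_cover_mass s_gt0 growth r_gt0 r_to0 u_gt0 u_lt t_le full lam0
  lam_small rho0 compactX d0 d1 cov).
Qed.
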